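(* Let $M,N,K$ be positive integers and let $X^\star=A_{rf}D_{\tilde c}\Phi^\top\in\mathbb{C}^{M\times N}$ be a noiseless data matrix with true damping-frequency pairs $\mathcal{RF}=\{(r_1,f_1),\dots,(r_K,f_K)\}$, $r_k\in[0,1]$, $f_k\in[0,1)$, as described in the context. Assume that $M\ge K+1$, that all the pairs $(r_k,f_k)$ in $\mathcal{RF}$ are distinct, and that $\Phi\in\mathbb{C}^{N\times K}$ has rank $K$. Let $X^\star=U_{X^\star}S_{X^\star}V_{X^\star}^H$ be a truncated SVD of $X^\star$. Then for every $Q\in\partial\|X^\star\|_*$, i.e. every $Q=U_{X^\star}V_{X^\star}^H+W$ with $U_{X^\star}^HW=0$, $WV_{X^\star}=0$, $\|W\|\le 1$, such that moreover $\|W\|<1$, the dual polynomial $\mathcal{Q}(r,f)=Q^Ha(r,f)$ satisfies $$\|\mathcal{Q}(r_k,f_k)\|_2=1\quad\text{for all }(r_k,f_k)\in\mathcal{RF},$$ $$\|\mathcal{Q}(r,f)\|_2<1\quad\text{for all }(r,f)\notin\mathcal{RF},$$ where $(r,f)$ ranges over $[0,1]\times[0,1)$.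
   Context: For $r\in[0,1]$ and $f\in[0,1)$ define the unit-norm vector $a(r,f)\in\mathbb{C}^M$ by $a(r,f)=\sqrt{\tfrac{1-r^2}{1-r^{2M}}}\,[1,\ re^{j2\pi f},\ \dots,\ r^{M-1}e^{j2\pi f(M-1)}]^\top$ if $r<1$, and $a(1,f)=\tfrac{1}{\sqrt M}[1,\ e^{j2\pi f},\ \dots,\ e^{j2\pi f(M-1)}]^\top$ (with $j=\sqrt{-1}$). Data matrix: let $c_1,\dots,c_K\in\mathbb{C}\setminus\{0\}$ and let $\phi_1,\dots,\phi_K\in\mathbb{C}^N$ with $\|\phi_k\|_2=1$. Put $\tilde c_k=c_k\sqrt{\tfrac{1-r_k^{2M}}{1-r_k^2}}$ if $r_k<1$ and $\tilde c_k=c_k\sqrt M$ if $r_k=1$; $A_{rf}=[a(r_1,f_1),\dots,a(r_K,f_K)]\in\mathbb{C}^{M\times K}$, $D_{\tilde c}=\mathrm{diag}(\tilde c_1,\dots,\tilde c_K)$, $\Phi=[\phi_1,\dots,\phi_K]\in\mathbb{C}^{N\times K}$. The data matrix is $X^\star=A_{rf}D_{\tilde c}\Phi^\top$. $\top$ is transpose, $H$ is conjugate transpose, $\|\cdot\|_*$ is the nuclear norm, $\partial\|X^\star\|_*$ its subdifferential at $X^\star$, $\|\cdot\|$ the spectral norm. A truncated SVD keeps only the nonzero singular values; here $U_{X^\star}\in\mathbb{C}^{M\times K}$, $S_{X^\star}\in\mathbb{R}^{K\times K}$, $V_{X^\star}\in\mathbb{C}^{N\times K}$.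
   Formalization: Since a(0,f) is the same vector for every f, the strict inequality is claimed only for (r,f) that differ from every true pair when frequencies are ignored at r=0: points (0,f) are excluded if some r_k=0, where the norm is in fact 1. *)

(* Defs.v *)
From HB Require Import structures.
From mathcomp Require Import all_boot all_order all_algebra.
From mathcomp Require Import spectral complex.
From mathcomp Require Import all_classical all_reals all_analysis.

Set Implicit Arguments.
Unset Strict Implicit.
Unset Printing Implicit Defensive.

Import Order.TTheory GRing.Theory Num.Theory.
Import numFieldNormedType.Exports.

Local Open Scope classical_set_scope.
Local Open Scope ring_scope.
Local Open Scope complex_scope.
Local Open Scope sesquilinear_scope.

Definition expi (R : realType) (t : R) : R[i] := cos t +i* sin t.

Definition l2norm (R : realType) (n : nat) (x : 'cV[R[i]]_n) : R :=
  Num.sqrt (\sum_(i < n) ComplexField.Normc.normc (x i 0) ^+ 2).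

Definition spectral_norm (R : realType) (m n : nat) (W : 'M[R[i]]_(m, n)) : R :=
  sup [set l2norm (W *m x) | x in [set x : 'cV[R[i]]_n | l2norm x <= 1]].

(* Since 0 ^+ 0 = 1, the first coordinate is the normalization factor even
   when r = 0, so that avec M 0 f is the first basis vector for every f. *)
Definition avec (R : realType) (M : nat) (r f : R) : 'cV[R[i]]_M :=
  (if r < 1 then Num.sqrt ((1 - r ^+ 2) / (1 - r ^+ (2 * M)))
   else (Num.sqrt M%:R)^-1)%:C
  *: \col_(m < M) ((r ^+ m)%:C * expi (2 * pi * f * m%:R)).

Definition ctilde (R : realType) (M : nat) (r : R) (c : R[i]) : R[i] :=
  c * (if r < 1 then Num.sqrt ((1 - r ^+ (2 * M)) / (1 - r ^+ 2))
       else Num.sqrt M%:R)%:C.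

Definition Arf (R : realType) (M K : nat) (r f : 'I_K -> R) : 'M[R[i]]_(M, K) :=
  \matrix_(m, k) avec M (r k) (f k) m 0.

Definition data_matrix (R : realType) (M N K : nat) (r f : 'I_K -> R)
    (c : 'I_K -> R[i]) (Phi : 'M[R[i]]_(N, K)) : 'M[R[i]]_(M, N) :=
  Arf M r f *m diag_mx (\row_k ctilde M (r k) (c k)) *m Phi^T.

(* The number K of retained singular values is part of the type: a truncated
   SVD of this size exists only if X has rank K. *)
Definition truncated_svd (R : realType) (M N K : nat) (X : 'M[R[i]]_(M, N))
    (U : 'M[R[i]]_(M, K)) (S : 'M[R]_K) (V : 'M[R[i]]_(N, K)) : Prop :=
  [/\ U ^t* *m U = 1%:M,
      V ^t* *m V = 1%:M,
      is_diag_mx S,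
      (forall k, 0 < S k k)
    & X = U *m map_mx (real_complex R) S *m V ^t*].

(* Q belongs to the subdifferential of the nuclear norm at any matrix with
   truncated SVD factors U, V, with W the component of Q beyond U V^H. *)
Definition nuclear_subgradient (R : realType) (M N K : nat)
    (U : 'M[R[i]]_(M, K)) (V : 'M[R[i]]_(N, K)) (Q W : 'M[R[i]]_(M, N)) : Prop :=
  [/\ Q = U *m V ^t* + W,
      U ^t* *m W = 0,
      W *m V = 0
    & spectral_norm W <= 1].

Definition dual_poly (R : realType) (M N : nat) (Q : 'M[R[i]]_(M, N)) (r f : R) :
    'cV[R[i]]_N :=
  Q ^t* *m avec M r f.

(* Equality of damping-frequency pairs, except that the frequency is ignored
   at r = 0, where avec does not depend on it: were (0, f) and (0, f') told
   apart, the dual polynomial would have norm 1 off the set of true pairs as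
   soon as some true damping is 0. *)
Definition same_pair (R : realType) (p q : R * R) : Prop :=
  p.1 = q.1 /\ (p.1 = 0 \/ p.2 = q.2).

(* Main.v *)
(* The truncated SVD and X = Arf D Phi^T give U = Arf B with B invertible, so
   each atom a_k lies in the range of U; hence Q^H a_k = V U^H a_k, which has
   the norm of a_k, namely 1.  An atom a off the true pairs has a node
   r e^(j2 pi f) different from the K true nodes, and the polynomial with these
   roots, of degree K < M, separates a from the range of Arf.  So
   a = U y + w with w <> 0 orthogonal to the range of U, and
   |Q^H a|^2 = |y|^2 + |W^H w|^2 < |y|^2 + |w|^2 = 1. *)
Require Import Defs.
From HB Require Import structures.
From mathcomp Require Import all_boot all_order all_algebra.
From mathcomp Require Import spectral complex ring lra.
From mathcomp Require Import all_classical all_reals all_analysis.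

Set Implicit Arguments.
Unset Strict Implicit.
Unset Printing Implicit Defensive.

Import Order.TTheory GRing.Theory Num.Theory.
Import numFieldNormedType.Exports.

Local Open Scope ring_scope.

Local Open Scope complex_scope.
Local Open Scope sesquilinear_scope.

Import ComplexField.Normc.

(** * Adjoints and the Euclidean norm *)

Lemma adjmx_mul (C : numClosedFieldType) (m n p : nat)
    (A : 'M[C]_(m, n)) (B : 'M[C]_(n, p)) :
  (A *m B) ^t* = B ^t* *m A ^t*.
Proof. by rewrite trmx_mul map_mxM. Qed.

Lemma adjmxD (C : numClosedFieldType) (m n : nat) (A B : 'M[C]_(m, n)) :
  (A + B) ^t* = A ^t* + B ^t*.
Proof. by rewrite linearD (map_mxD Num.conj). Qed.

Lemma adjmxB (C : numClosedFieldType) (m n : nat) (A B : 'M[C]_(m, n)) :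
  (A - B) ^t* = A ^t* - B ^t*.
Proof. by rewrite linearB (map_mxB Num.conj). Qed.

Lemma normc_ge0 (R : realType) (z : R[i]) : 0 <= normc z.
Proof. by case: z => a b; exact: sqrtr_ge0. Qed.

Lemma l2norm_ge0 (R : realType) (n : nat) (x : 'cV[R[i]]_n) : 0 <= l2norm x.
Proof. exact: sqrtr_ge0. Qed.

Lemma l2norm_sqr (R : realType) (n : nat) (x : 'cV[R[i]]_n) :
  l2norm x ^+ 2 = \sum_(i < n) normc (x i 0) ^+ 2.
Proof. by rewrite sqr_sqrtr// sumr_ge0// => i _; rewrite sqr_ge0. Qed.

(** Squared norms become 1 by 1 matrices, so that norm identities follow from matrix algebra and are
    read back at the entry (0, 0). *)
Lemma l2norm_adjmx (R : realType) (n : nat) (x : 'cV[R[i]]_n) :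
  x ^t* *m x = ((l2norm x ^+ 2)%:C)%:M.
Proof.
apply/matrixP => i j; rewrite !ord1 !mxE l2norm_sqr mulr1n rmorph_sum /=.
apply: eq_bigr => k _; rewrite !mxE -normCKC normc_def -rmorphXn /=.
by case: (x k 0).
Qed.

Lemma l2norm_sqrP (R : realType) (n m : nat) (x : 'cV[R[i]]_n)
    (y : 'cV[R[i]]_m) :
  x ^t* *m x = y ^t* *m y -> l2norm x = l2norm y.
Proof.
rewrite !l2norm_adjmx => /matrixP /(_ 0 0); rewrite !mxE !mulr1n => -[h].
by apply/eqP; rewrite -(@eqrXn2 _ 2) ?l2norm_ge0// h.
Qed.

Lemma l2norm_isometry (R : realType) (m n : nat) (U : 'M[R[i]]_(m, n))
    (x : 'cV[R[i]]_n) : U ^t* *m U = 1%:M -> l2norm (U *m x) = l2norm x.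
Proof.
move=> hU; apply: l2norm_sqrP.
by rewrite adjmx_mul mulmxA -(mulmxA _ _ U) hU mulmx1.
Qed.

Lemma l2norm_pythagoras (R : realType) (n : nat) (x y : 'cV[R[i]]_n) :
  x ^t* *m y = 0 -> l2norm (x + y) ^+ 2 = l2norm x ^+ 2 + l2norm y ^+ 2.
Proof.
move=> xy; have yx : y ^t* *m x = 0.
  by rewrite -[x]trmxCK -adjmx_mul xy trmx0 map_mx0.
suff /matrixP/(_ 0 0) : ((l2norm (x + y) ^+ 2)%:C)%:M =
    ((l2norm x ^+ 2)%:C)%:M + ((l2norm y ^+ 2)%:C)%:M :> 'M[R[i]]_1.
  by rewrite !mxE !mulr1n -rmorphD => -[].
rewrite -!l2norm_adjmx adjmxD mulmxDl !mulmxDr.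
by rewrite xy yx addr0 add0r.
Qed.

Lemma l2norm0 (R : realType) (n : nat) : l2norm (0 : 'cV[R[i]]_n) = 0.
Proof.
by rewrite /l2norm big1 ?sqrtr0// => i _; rewrite mxE normc0 expr0n.
Qed.

Lemma l2norm_eq0 (R : realType) (n : nat) (x : 'cV[R[i]]_n) :
  (l2norm x == 0) = (x == 0).
Proof.
apply/eqP/eqP => [x0|->]; last exact: l2norm0.
have := l2norm_sqr x; rewrite x0 expr0n => /esym/eqP.
rewrite psumr_eq0 => [/allP h|i _]; last by rewrite sqr_ge0.
apply/matrixP => i j; rewrite ord1 mxE; apply: eq0_normc; apply/eqP.
by have := h i (mem_index_enum i); rewrite sqrf_eq0.
Qed.

Lemma normc_real (R : realType) (t : R) : normc (t%:C) = `|t|.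
Proof. by rewrite /normc /= expr0n addr0 sqrtr_sqr. Qed.

Lemma l2normZ (R : realType) (n : nat) (t : R) (x : 'cV[R[i]]_n) :
  l2norm (t%:C *: x) = `|t| * l2norm x.
Proof.
apply/eqP; rewrite -(@eqrXn2 _ 2) ?mulr_ge0 ?l2norm_ge0//.
rewrite exprMn !l2norm_sqr mulr_sumr; apply/eqP/eq_bigr => i _.
by rewrite mxE normcM exprMn normc_real.
Qed.

(** * The spectral norm as an operator bound *)

Lemma normc_le_l2norm (R : realType) (n : nat) (x : 'cV[R[i]]_n) (i : 'I_n) :
  normc (x i 0) <= l2norm x.
Proof.
rewrite -(@ler_pXn2r _ 2) ?nnegrE ?normc_ge0 ?l2norm_ge0// l2norm_sqr.
by rewrite (bigD1 i)//= lerDl sumr_ge0// => j _; rewrite sqr_ge0.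
Qed.

(** The [sup] in [spectral_norm] is meaningful only for a bounded set. Entries of [x] have modulus
    at most 1, so each entry of [W *m x] is bounded by the sum of the moduli in its row. *)
Lemma l2norm_mulmx_bounded (R : realType) (m n : nat) (W : 'M[R[i]]_(m, n)) :
  exists C : R, forall x : 'cV[R[i]]_n, l2norm x <= 1 -> l2norm (W *m x) <= C.
Proof.
exists (Num.sqrt (\sum_i (\sum_j normc (W i j)) ^+ 2)) => x x1.
apply: ler_wsqrtr; apply: ler_sum => i _; apply: lerXn2r.
- by rewrite nnegrE normc_ge0.
- by rewrite nnegrE sumr_ge0// => j _; exact: normc_ge0.
rewrite mxE; apply: (@le_trans _ _ (\sum_j normc (W i j * x j 0))).
  elim/big_ind2 : _ => [|u a v b ua vb|//]; first by rewrite normc0.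
  exact: le_trans (le_normcD _ _) (lerD ua vb).
apply: ler_sum => j _; rewrite normcM ler_piMr ?normc_ge0//.
exact: le_trans (normc_le_l2norm _ _) x1.
Qed.

Lemma l2norm_mulmx_le (R : realType) (m n : nat) (W : 'M[R[i]]_(m, n))
    (x : 'cV[R[i]]_n) : l2norm (W *m x) <= spectral_norm W * l2norm x.
Proof.
have [->|x0] := eqVneq x 0.
  by rewrite mulmx0 !l2norm0 mulr0.
have lx : 0 < l2norm x by rewrite lt_neqAle l2norm_ge0 eq_sym l2norm_eq0 x0.
(* The quotient by [l2norm x] is the norm of [W] applied to the normalized [x], a member of the set
   under [sup]. *)
rewrite -ler_pdivrMr// mulrC -[X in X * _]ger0_norm ?invr_ge0 ?l2norm_ge0//.
rewrite -l2normZ scalemxAr; have [C hC] := l2norm_mulmx_bounded W.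
apply: ub_le_sup.
  by exists C => _ [y /= y1 <-]; exact: hC.
exists ((l2norm x)^-1%:C *: x) => //=.
by rewrite l2normZ ger0_norm ?invr_ge0 ?l2norm_ge0// mulVf ?gt_eqF.
Qed.

(** This bypasses the equality of the spectral norms of W and W^H. With u = W^H w nonzero, 0 <= |w -
    W u|^2 gives 2 |u|^2 <= |w|^2 + |W u|^2 < |w|^2 + |u|^2. *)
Lemma l2norm_adjmx_lt (R : realType) (m n : nat) (W : 'M[R[i]]_(m, n))
    (w : 'cV[R[i]]_m) :
  spectral_norm W < 1 -> w != 0 -> l2norm (W ^t* *m w) < l2norm w.
Proof.
move=> hW w0; set u := W ^t* *m w.
have [->|u0] := eqVneq u 0.
  by rewrite l2norm0 lt_neqAle l2norm_ge0 eq_sym l2norm_eq0 w0.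
have lu : 0 < l2norm u by rewrite lt_neqAle l2norm_ge0 eq_sym l2norm_eq0 u0.
have Wu : l2norm (W *m u) < l2norm u.
  by apply: le_lt_trans (l2norm_mulmx_le W u) _; rewrite gtr_pMl.
(* |w - W u|^2 = |w|^2 - 2 |u|^2 + |W u|^2 because w^H W u = |u|^2 *)
have e : l2norm (w - W *m u) ^+ 2 =
    l2norm w ^+ 2 - (l2norm u ^+ 2 + l2norm u ^+ 2) + l2norm (W *m u) ^+ 2.
  have wWu : w ^t* *m (W *m u) = u ^t* *m u.
    by rewrite [in RHS]/u adjmx_mul trmxCK -mulmxA.
  have uWw : (W *m u) ^t* *m w = u ^t* *m u.
    by rewrite adjmx_mul -mulmxA.
  suff /matrixP/(_ 0 0) : ((l2norm (w - W *m u) ^+ 2)%:C)%:M =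
      ((l2norm w ^+ 2)%:C)%:M - (((l2norm u ^+ 2)%:C)%:M + ((l2norm u ^+ 2)%:C)%:M) +
      ((l2norm (W *m u) ^+ 2)%:C)%:M :> 'M[R[i]]_1.
    by rewrite !mxE !mulr1n -!rmorphD -rmorphB -rmorphD => -[].
  rewrite -!l2norm_adjmx adjmxB mulmxBl !mulmxBr.
  by rewrite wWu uWw !opprB opprD !addrA addrAC.
rewrite -(@ltr_pXn2r _ 2) ?nnegrE ?l2norm_ge0//.
have := sqr_ge0 (l2norm (w - W *m u)); rewrite e.
have : l2norm (W *m u) ^+ 2 < l2norm u ^+ 2.
  by rewrite ltr_pXn2r ?nnegrE ?l2norm_ge0.
by lra.
Qed.

(** * Complex exponentials and nodes *)

Lemma expi_mulrn (R : realType) (t : R) (n : nat) :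
  expi (t * n%:R) = expi t ^+ n.
Proof.
elim: n => [|n IH]; first by rewrite mulr0 /expi cos0 sin0 expr0.
rewrite exprSr -IH -[in LHS]natr1 mulrDr mulr1 /expi cosD sinD.
by apply/eqP; rewrite eq_complex /=; apply/andP; split; apply/eqP; ring.
Qed.

Lemma normc_expi (R : realType) (t : R) : normc (expi t) = 1.
Proof. by rewrite /normc /expi cos2Dsin2 sqrtr1. Qed.

(** Equal exponentials give cos (2 pi (y - x)) = 1, hence sin (pi (y - x)) = 0 by the double angle
    formula; but for x < y the angle pi (y - x) lies strictly between 0 and pi. *)
Lemma expi_inj (R : realType) (x y : R) :
  0 <= x < 1 -> 0 <= y < 1 -> expi (2 * pi * x) = expi (2 * pi * y) -> x = y.
Proof.
wlog : x y / x <= y.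
  move=> h hx hy e; have [xy|/ltW yx] := leP x y; first exact: h.
  by apply/esym/h.
move=> xy /andP[x0 x1] /andP[y0 y1] [ec es].
apply/eqP/negP => /negP xny.
have lt_xy : x < y by rewrite lt_neqAle xny.
have : cos (2 * pi * y - 2 * pi * x) = 1.
  by rewrite cosB ec es -!expr2 cos2Dsin2.
have -> : 2 * pi * y - 2 * pi * x = (pi * (y - x)) *+ 2 by ring.
rewrite cos_mulr2n cos2sin2 => hs.
have : 0 < sin (pi * (y - x)).
  apply: sin_gt0_pi; rewrite pmulr_rgt0 ?pi_gt0// subr_gt0 lt_xy /=.
  by rewrite gtr_pMr ?pi_gt0//; lra.
by rewrite mulr2n in hs; nra.
Qed.

(** The ratio of the geometric progression formed by the entries of an atom. *)
Definition node (R : realType) (r f : R) : R[i] := r%:C * expi (2 * pi * f).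

(** The modulus of the node recovers r; dividing by r recovers f unless r = 0, which is the
    exception built into [same_pair]. *)
Lemma node_inj (R : realType) (r f r' f' : R) :
  0 <= r -> 0 <= r' -> 0 <= f < 1 -> 0 <= f' < 1 ->
  node r f = node r' f' -> same_pair (r, f) (r', f').
Proof.
move=> r0 r0' hf hf' e.
have rr : r = r'.
  have := congr1 (@normc R) e.
  by rewrite !normcM !normc_expi !mulr1 !normc_real !ger0_norm.
split=> //=; have [->|rn0] := eqVneq r 0; [by left | right].
apply: expi_inj => //; move: e; rewrite /node -rr => /mulfI; apply.
by apply/eqP => -[/eqP]; rewrite (negbTE rn0).
Qed.

(** * Atoms: normalization and separation by polynomials *)

Definition avec_factor (R : realType) (M : nat) (r : R) : R :=
  if r < 1 then Num.sqrt ((1 - r ^+ 2) / (1 - r ^+ (2 * M)))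
  else (Num.sqrt M%:R)^-1.

Lemma avecE (R : realType) (M : nat) (r f : R) (m : 'I_M) :
  avec M r f m 0 = (avec_factor M r)%:C * node r f ^+ m.
Proof. by rewrite !mxE exprMn expi_mulrn rmorphXn. Qed.

Lemma avec_factor_sqr (R : realType) (M : nat) (r : R) :
  (0 < M)%N -> 0 <= r <= 1 ->
  avec_factor M r ^+ 2 * \sum_(m < M) (r ^+ 2) ^+ m = 1.
Proof.
move=> M0 /andP[r0 r1]; rewrite /avec_factor; case: ltP => [lt_r1|ge_r1].
  have q1 : r ^+ 2 < 1 by rewrite expr_lt1.
  have q2 : r ^+ (2 * M) < 1 by rewrite expr_lt1// muln_gt0.
  rewrite sqr_sqrtr ?divr_ge0 ?subr_ge0 ?ltW//.
  (* The geometric sum of ratio r^2, multiplied by 1 - r^2, is 1 - r^(2 M). *)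
  rewrite mulrAC -opprB mulNr -subrX1 -exprM opprB mulfV//.
  by rewrite subr_eq0 gt_eqF.
have -> : r = 1 by apply/le_anti; rewrite r1.
rewrite exprVn sqr_sqrtr ?ler0n// expr1n.
rewrite (eq_bigr (fun=> 1)) => [|i _]; last by rewrite expr1n.
by rewrite sumr_const card_ord mulVf// pnatr_eq0 -lt0n.
Qed.

Lemma l2norm_avec (R : realType) (M : nat) (r f : R) :
  (0 < M)%N -> 0 <= r <= 1 -> l2norm (avec M r f) = 1.
Proof.
move=> M0 hr; apply/eqP; rewrite -(@eqrXn2 _ 2) ?l2norm_ge0// expr1n.
rewrite l2norm_sqr -(avec_factor_sqr M0 hr) mulr_sumr; apply/eqP.
apply: eq_bigr => m _; rewrite mxE mxE !normcM normc_expi mulr1.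
by rewrite !normc_real exprMn !real_normK ?num_real// exprAC.
Qed.

(** An atom is a scaled vector of powers of its node, so pairing it with a coefficient row evaluates
    the polynomial there; the size bound ensures that no coefficient is cut off. *)
Lemma row_coef_avec (R : realType) (M : nat) (p : {poly R[i]}) (r f : R) :
  (size p <= M)%N ->
  (\row_(m < M) p`_m) *m avec M r f =
    ((avec_factor M r)%:C * p.[node r f])%:M.
Proof.
move=> sp; apply/matrixP => i j; rewrite !ord1 !mxE mulr1n.
rewrite (horner_coef_wide _ sp) mulr_sumr; apply: eq_bigr => m _.
by rewrite [(\row__ _) _ _]mxE avecE mulrCA.
Qed.

Lemma avec_notin_range (R : realType) (M K : nat) (r f : 'I_K -> R)
    (r0 f0 : R) (x : 'cV[R[i]]_K) :
  (K < M)%N -> 0 <= r0 <= 1 -> (forall k, node r0 f0 != node (r k) (f k)) ->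
  avec M r0 f0 <> Arf M r f *m x.
Proof.
move=> KM hr0 hne.
(* Of size K + 1 <= M, so its coefficients fit in a row of length M; that row annihilates
   [Arf M r f] but not the atom at (r0, f0). *)
pose p := \prod_(k < K) ('X - (node (r k) (f k))%:P).
have sp : (size p <= M)%N
  by rewrite /p -big_enum /= size_prod_XsubC size_enum_ord.
have p0 : (\row_(m < M) p`_m) *m Arf M r f = 0.
  apply/matrixP => i k; rewrite mxE [RHS]mxE ord1.
  have /matrixP/(_ 0 0) := row_coef_avec (r k) (f k) sp.
  have -> : p.[node (r k) (f k)] = 0.
    by apply/eqP; rewrite horner_prod (bigD1 k)//= !hornerE subrr mul0r.
  rewrite mulr0 !mxE mul0rn => pk; rewrite -[RHS]pk.
  by apply: eq_bigr => m _; rewrite [Arf _ _ _ _ _]mxE.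
move/(congr1 (mulmx (\row_(m < M) p`_m))).
rewrite row_coef_avec// mulmxA p0 mul0mx => /matrixP/(_ 0 0)/eqP.
(* Either the normalization factor vanishes, against [avec_factor_sqr], or the node of (r0, f0) is
   one of the roots. *)
rewrite !mxE mulr1n mulf_eq0 => /orP[/eqP[fac0]|].
  have := avec_factor_sqr (leq_ltn_trans (leq0n K) KM) hr0.
  by move/eqP; rewrite fac0 expr0n mul0r eq_sym oner_eq0.
rewrite horner_prod => /prodf_eq0[k _].
by rewrite !hornerE subr_eq0 (negbTE (hne k)).
Qed.

(** * Range of the singular vectors and action of a subgradient *)

Lemma truncated_svd_range (R : realType) (M N K : nat) (X : 'M[R[i]]_(M, N))
    (U : 'M[R[i]]_(M, K)) (S : 'M[R]_K) (V : 'M[R[i]]_(N, K))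
    (A : 'M[R[i]]_(M, K)) (Y : 'M[R[i]]_(K, N)) :
  truncated_svd X U S V -> X = A *m Y ->
  exists2 B, U = A *m B & A = U *m (U ^t* *m A).
Proof.
case=> UU VV dS S0 XE XA.
have uS : map_mx (real_complex R) S \in unitmx.
  rewrite map_unitmx unitmxE det_trig ?is_diag_mx_is_trig// unitfE.
  by apply/prodf_neq0 => k _; exact: lt0r_neq0.
(* Obtained by solving A Y = U S V^H for U: multiply on the right by V, then by the inverse of S. *)
pose B := Y *m V *m invmx (map_mx (real_complex R) S).
have UA : U = A *m B.
  by rewrite /B !mulmxA -XA XE -[_ *m V]mulmxA VV mulmx1 mulmxK.
exists B => //.
(* As [B] is square, its left inverse U^H A is also a right inverse, whence U (U^H A) = A B (U^H A)
   = A. *)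
have : U ^t* *m A *m B = 1%:M by rewrite -mulmxA -UA.
by move/mulmx1C => BUA; rewrite [X in X *m _]UA -mulmxA BUA mulmx1.
Qed.

(** Since Q^H = V U^H + W^H, the cross terms W^H U y and V U^H w vanish: Q^H acts separately on the
    range of U and on its orthogonal complement. *)
Lemma adj_nuclear_subgradient (R : realType) (M N K : nat)
    (U : 'M[R[i]]_(M, K)) (V : 'M[R[i]]_(N, K)) (Q W : 'M[R[i]]_(M, N))
    (y : 'cV[R[i]]_K) (w : 'cV[R[i]]_M) :
  U ^t* *m U = 1%:M -> nuclear_subgradient U V Q W -> U ^t* *m w = 0 ->
  Q ^t* *m (U *m y + w) = V *m y + W ^t* *m w.
Proof.
move=> UU [-> UW _ _] Uw.
have WU : W ^t* *m U = 0.
  by rewrite -[U]trmxCK -adjmx_mul UW trmx0 map_mx0.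
rewrite adjmxD adjmx_mul trmxCK mulmxDl !mulmxDr !mulmxA.
by rewrite -(mulmxA V) UU mulmx1 WU mul0mx add0r -(mulmxA V) Uw mulmx0 addr0.
Qed.

Theorem theorem4p1 (R : realType) (M N K : nat)
    (hM : (0 < M)%N) (hN : (0 < N)%N) (hK : (0 < K)%N)
    (r f : 'I_K -> R) (c : 'I_K -> R[i]) (Phi : 'M[R[i]]_(N, K))
    (hr : forall k, 0 <= r k <= 1)
    (hf : forall k, 0 <= f k < 1)
    (hc : forall k, c k != 0)
    (hPhi_unit : forall k, l2norm (col k Phi) = 1)
    (hMK : (K + 1 <= M)%N)
    (hdistinct : injective (fun k => (r k, f k)))
    (hPhi_rank : \rank Phi = K)
    (U : 'M[R[i]]_(M, K)) (S : 'M[R]_K) (V : 'M[R[i]]_(N, K))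
    (hsvd : truncated_svd (data_matrix M r f c Phi) U S V)
    (Q W : 'M[R[i]]_(M, N))
    (hQ : nuclear_subgradient U V Q W)
    (hW : spectral_norm W < 1) :
  (forall k, l2norm (dual_poly Q (r k) (f k)) = 1) /\
  (forall r0 f0 : R, 0 <= r0 <= 1 -> 0 <= f0 < 1 ->
     (forall k, ~ same_pair (r0, f0) (r k, f k)) ->
     l2norm (dual_poly Q r0 f0) < 1).
Proof.
case: (hsvd) => UU VV _ _ _.
have [B UA AU] : exists2 B, U = Arf M r f *m B &
    Arf M r f = U *m (U ^t* *m Arf M r f).
  by apply: truncated_svd_range hsvd _; rewrite /data_matrix -mulmxA.
split=> [k|r0 f0 hr0 hf0 hne].
  (* Column k of [AU], with a zero orthogonal component to match the form of
     [adj_nuclear_subgradient]. *)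
  have ak : avec M (r k) (f k) = U *m (U ^t* *m avec M (r k) (f k)) + 0.
    have /(congr1 (col k)) := AU; rewrite !colE -!mulmxA -colE addr0.
    suff -> : col k (Arf M r f) = avec M (r k) (f k) by [].
    by apply/matrixP => i j; rewrite ord1 !mxE.
  rewrite -(l2norm_avec (f k) hM (hr k)) /dual_poly ak.
  rewrite (adj_nuclear_subgradient _ UU hQ) ?mulmx0// !addr0.
  by rewrite (l2norm_isometry _ VV) (l2norm_isometry _ UU).
(* U y is the orthogonal projection of a onto the range of U, and w is the residual. *)
set a := avec M r0 f0; pose y := U ^t* *m a; pose w := a - U *m y.
have aE : a = U *m y + w by rewrite addrC subrK.
have Uw : U ^t* *m w = 0 by rewrite mulmxBr mulmxA UU mul1mx subrr.
have w0 : w != 0.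
  apply/eqP => w0; have : a = Arf M r f *m (B *m y).
    by rewrite mulmxA -UA aE w0 addr0.
  apply: avec_notin_range => //; first by rewrite -addn1.
  move=> k; apply/eqP => e; apply: (hne k).
  case/andP: hr0 => ? _; case/andP: (hr k) => ? _.
  exact: node_inj.
have a1 : l2norm a ^+ 2 = l2norm y ^+ 2 + l2norm w ^+ 2.
  rewrite {1}aE l2norm_pythagoras ?(l2norm_isometry _ UU)//.
  by rewrite adjmx_mul -mulmxA Uw mulmx0.
have WV : W *m V = 0 by case: hQ.
rewrite -(@ltr_pXn2r _ 2) ?nnegrE ?l2norm_ge0// /dual_poly -/a.
(* The bound 1 is rewritten as |a|^2 = |y|^2 + |w|^2, so that after cancelling |y|^2 only |W^H w| <
   |w| remains. *)
rewrite -[X in _ < X ^+ 2](l2norm_avec f0 hM hr0) a1.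
rewrite aE (adj_nuclear_subgradient _ UU hQ Uw) l2norm_pythagoras.
  rewrite (l2norm_isometry _ VV) ltrD2l ltr_pXn2r ?nnegrE ?l2norm_ge0//.
  exact: l2norm_adjmx_lt.
(* Orthogonality of V y and W^H w: their inner product is y^H (W V)^H w, and W V = 0. *)
rewrite mulmxA -adjmx_mul mulmxA WV mul0mx trmx0.
by rewrite (map_mx0 Num.conj) mul0mx.
Qed.
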